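(* Let $\{G_n\}$ be a sequence of graphs, where $G_n$ is a connected graph on $n$ vertices with maximum degree $\Delta = \Delta(G_n)$ and average degree $\bar d = \bar d(G_n)$. Then $$ q^*(G_n) \ge \frac{2}{\bar d} - 3\sqrt{\frac{\Delta}{n \bar d}} - \frac{\Delta}{n \bar d}. $$
   Context: Graphs are finite and simple. Modularity: for a graph $G$ with at least one edge and a partition $\mathcal{A} = \{A_1,\dots,A_k\}$ of $V(G)$, $$q_{\mathcal{A}}(G) = \sum_{A \in \mathcal{A}} \left( \frac{e(A)}{|E(G)|} - \frac{(\sum_{v\in A}\deg(v))^2}{4|E(G)|^2}\right),$$ where $e(A) = |\{uv \in E(G): u,v\in A\}|$ is the number of edges inside $A$. The modularity of $G$ is $q^*(G) = \max_{\mathcal{A}} q_{\mathcal{A}}(G)$, the maximum over all partitions $\mathcal{A}$ of $V(G)$. (In particular $G_n$ is assumed to have at least one edge, so $n \ge 2$.) The average degree is $\bar d(G_n) = 2|E(G_n)|/n$. *)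

(* Defs.v *)
From mathcomp Require Import all_boot all_order all_algebra.

Set Implicit Arguments.
Unset Strict Implicit.
Unset Printing Implicit Defensive.

Import Order.TTheory GRing.Theory Num.Theory.

Local Open Scope ring_scope.

Record graph := Graph {
  vertex :> finType;
  adj : rel vertex;
  adj_sym : symmetric adj;
  adj_irrefl : irreflexive adj
}.

Definition connected (G : graph) : bool :=
  (0 < #|G|)%N && [forall u : G, forall v : G, connect (@adj G) u v].

(* An edge is the unordered pair [set u; v] of two adjacent vertices, so each
   edge is counted once. *)
Definition edges (G : graph) : {set {set G}} :=
  [set [set u; v] | u in [set: G], v in [set: G] & adj u v].

Definition num_edges (G : graph) : nat := #|edges G|.

Definition num_edges_in (G : graph) (A : {set G}) : nat :=
  #|[set E in edges G | E \subset A]|.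

Definition degree (G : graph) (v : G) : nat := #|[set w : G | adj v w]|.

Definition max_degree (G : graph) : nat := \max_(v : G) degree v.

Definition avg_degree (R : rcfType) (G : graph) : R :=
  2%:R * (num_edges G)%:R / #|G|%:R.

Definition partition_modularity (R : rcfType) (G : graph)
    (P : {set {set G}}) : R :=
  \sum_(A in P)
    ((num_edges_in A)%:R / (num_edges G)%:R
     - ((\sum_(v in A) degree v)%N%:R) ^+ 2
       / (4%:R * (num_edges G)%:R ^+ 2)).

Definition singletons (G : graph) : {set {set G}} :=
  [set [set v] | v in [set: G]].

Lemma singletons_partition (G : graph) : partition (singletons G) [set: G].
Proof.
apply/and3P; split.
- rewrite eqEsubset subsetT /=; apply/subsetP=> v _.
  by apply/bigcupP; exists [set v]; rewrite ?set11 // imset_f ?inE.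
- apply/trivIsetP=> _ _ /imsetP[u _ ->] /imsetP[v _ ->] neq.
  by rewrite disjoints1 inE; apply: contraNneq neq => ->.
- by apply/imsetP=> -[v _ /setP/(_ v)]; rewrite !inE eqxx.
Qed.

(* The default value of the iterated maximum is itself the modularity of a
   partition of the vertex set, so this is a genuine maximum over partitions;
   see modularity_ge and modularity_attained. *)
Definition modularity (R : rcfType) (G : graph) : R :=
  \big[Num.max/partition_modularity R (singletons G)]_(P : {set {set G}}
      | partition P [set: G]) partition_modularity R P.

Lemma modularity_ge (R : rcfType) (G : graph) (P : {set {set G}}) :
  partition P [set: G] -> partition_modularity R P <= modularity R G.
Proof. by move=> partP; apply: le_bigmax_cond. Qed.

Lemma modularity_attained (R : rcfType) (G : graph) :
  exists2 P : {set {set G}},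
    partition P [set: G] & modularity R G = partition_modularity R P.
Proof.
rewrite /modularity; elim/big_ind: _ => [|x y [P pP ->] [Q pQ ->]|P pP].
- by exists (singletons G); rewrite ?singletons_partition.
- by case: (leP (partition_modularity R P)) => _; [exists Q|exists P].
- by exists P.
Qed.

(* Main.v *)
Require Import Defs.
From mathcomp Require Import all_boot all_order all_algebra.
From mathcomp Require Import ring lra.

(** Write m for the number of edges and D for the maximum degree, so that
    n * d = 2 m and 2 / d = n / m.  A partition into k pieces that keeps at
    least n - k edges inside its pieces, and whose pieces have volume (sum of
    degrees) at most M, has modularity at least (n - k) / m - M / (2 m): the
    squared volumes add up to at most M times the total volume 2 m.  It
    remains to find such a partition with k / m + M / (2 m) small.

    Cut a rooted spanning tree from the leaves upwards: whenever the part of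
    the graph still hanging from a vertex has volume at least a threshold s,
    detach it ([residual] is that volume, [tops] the vertices where a piece
    was detached, together with the root).  Every vertex that is not a top
    keeps its tree edge inside its piece, which gives n - k inner edges
    ([uncut_edges_le]).  A piece consists of its top and of subtrees of volume
    less than s hanging from children of the top, so its volume is at most
    D + s (D - 1), or D + s D for the root ([residual_le]).  Detached pieces
    have volume at least s, so s k <= 2 m, up to one light piece left at the
    root ([heavy_tops_count]).

    Either the root piece is light, which costs one extra piece but then all
    pieces obey the stronger volume bound, or it is heavy and nothing is lost
    in the count.  Since s >= 2, both cases give
    2 k + M <= D + D s + 4 m / s ([tops_residual_tradeoff]).  With
    s = sqrt (4 m / D) the last two terms are equal and
    k / m + M / (2 m) <= D / (2 m) + 2 sqrt 2 sqrt (D / (2 m)),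
    and 2 sqrt 2 <= 3. *)

Set Implicit Arguments.
Unset Strict Implicit.
Unset Printing Implicit Defensive.

Import Order.TTheory GRing.Theory Num.Theory.
Local Open Scope ring_scope.

(** * Degrees and edges *)

Definition volume (G : graph) (A : {set G}) : nat := (\sum_(v in A) degree v)%N.

(** The edges at v correspond to its neighbours.  This gives both the handshake
    identity and the bound of degrees by the number of edges. *)
Lemma card_incident_edges (G : graph) (v : G) :
  #|[set E in edges G | v \in E]| = degree v.
Proof.
rewrite /degree.
have -> : [set E in edges G | v \in E]
        = [set [set v; w] | w in [set w : G | adj v w]].
  apply/setP=> E; rewrite inE; apply/andP/imsetP.
    case=> /imset2P[a b _ /[!inE] /= ab ->] /[!inE] /orP[]/eqP->.
      by exists b; rewrite ?inE.
    by exists a; rewrite 1?setUC // inE adj_sym.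
  case=> w /[!inE] vw ->; split; last by rewrite !inE eqxx.
  by apply/imset2P; exists v w; rewrite ?inE.
rewrite card_in_imset // => a b /[!inE] va vb /setP/(_ a).
rewrite !inE eqxx orbT => /esym/orP[]/eqP // av.
by move: va; rewrite av adj_irrefl.
Qed.

Lemma card_edge (G : graph) (E : {set G}) : E \in edges G -> #|E| = 2%N.
Proof.
case/imset2P=> a b _ /[!inE] /= ab ->; rewrite cards2.
by case: eqP ab => // ->; rewrite adj_irrefl.
Qed.

(** Double counting of the pairs formed by an edge and one of its ends. *)
Lemma handshake (G : graph) : (\sum_(v : G) degree v = 2 * num_edges G)%N.
Proof.
under eq_bigr => v _ do rewrite -card_incident_edges -sum1dep_card.
rewrite (exchange_big_dep (mem (edges G))) /=; last by move=> v E _ /andP[].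
under eq_bigr => E Eedge.
  rewrite (eq_bigl (mem E)); last by move=> v; rewrite Eedge.
  rewrite sum1_card (card_edge Eedge); over.
by rewrite sum_nat_const mulnC.
Qed.

Lemma degree_le_max (G : graph) (v : G) : (degree v <= max_degree G)%N.
Proof. exact: (leq_bigmax v). Qed.

Lemma max_degree_le_num_edges (G : graph) : (max_degree G <= num_edges G)%N.
Proof.
apply/bigmax_leqP => v _; rewrite -card_incident_edges.
by apply: subset_leq_card; apply/subsetP => E /[!inE] /andP[].
Qed.

(** * Rooted spanning trees *)

(** Any strictly decreasing depth will do: it serves only to make climbing
    towards the root terminate. *)
Definition rooted_tree (G : graph) (r : G) (parent : G -> G) (depth : G -> nat) :=
  forall v, v != r -> adj v (parent v) && (depth (parent v) < depth v)%N.

(** Breadth-first search: the depth of v is the least length of a walk from r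
    to v, and the vertex before v on such a walk is closer to r. *)
Lemma spanning_tree_exists (G : graph) (r : G) :
  connected G -> exists parent depth, @rooted_tree G r parent depth.
Proof.
move=> /andP[_ /forallP/(_ r)/forallP conn].
pose ball k := iter k (fun B : {set G} => [set v | [exists u in B, adj u v]]) [set r].
have reached v : exists k, v \in ball k.
  have /connectP[q] := conn v.
  elim/last_ind: q v => [|q x IH] v /=; first by move=> _ ->; exists 0%N; rewrite inE.
  rewrite rcons_path last_rcons => /andP[rq qx] ->.
  have [k kq] := IH _ rq erefl.
  by exists k.+1; rewrite inE; apply/exists_inP; exists (last r q).
pose depth v := ex_minn (reached v).
have closer v : v != r -> exists u, adj v u && (depth u < depth v)%N.
  rewrite /depth; case: ex_minnP => -[|k] /=.
    by rewrite inE => ->.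
  (* A walk of length k.+1 to v passes through a neighbour u of v after k steps. *)
  rewrite inE => /exists_inP[u uk uv] _ _; exists u; rewrite adj_sym uv.
  by case: ex_minnP => j _; apply.
exists (fun v => odflt r [pick u | adj v u && (depth u < depth v)%N]), depth.
move=> v /closer[u uP]; case: pickP => [//|/(_ u)]; by rewrite uP.
Qed.

(** * Cutting a tree into heavy pieces *)

Section CuttingTree.

Variables (G : graph) (r : G) (parent : G -> G) (depth : G -> nat).
Hypothesis tree : rooted_tree r parent depth.
Variable heavy : pred nat.

Let child (v u : G) := (u != r) && (parent u == v).

(** The volume hanging from v once heavy subtrees have been detached satisfies
    a recursion over the children of v, see [residualE].  Children have larger
    depth, which is not structural, hence the fuel k; enough fuel makes the
    value independent of k. *)
Fixpoint residual_upto (k : nat) (v : G) : nat :=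
  if k is k'.+1 then
    (degree v + \sum_(u | child v u && ~~ heavy (residual_upto k' u))
                   residual_upto k' u)%N
  else 0.

Let height_bound := (\max_v depth v).+1.

(** Descending to a child spends one unit of fuel and gains one in depth. *)
Lemma residual_upto_stable k v :
  (height_bound <= k + depth v)%N -> residual_upto k.+1 v = residual_upto k v.
Proof.
elim: k v => [|k IH] v.
  by rewrite add0n ltnNge (leq_bigmax v).
move=> le_k; have stable u : child v u -> residual_upto k.+1 u = residual_upto k u.
  case/andP=> /tree/andP[_ +] /eqP pu; rewrite pu => lt_vu; apply: IH.
  by apply: leq_trans le_k _; rewrite addSnnS leq_add2l.
have unfold_upto j : residual_upto j.+1 v = (degree v
    + \sum_(u | child v u && ~~ heavy (residual_upto j u)) residual_upto j u)%N by [].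
rewrite (unfold_upto k.+1) (unfold_upto k); congr addn.
apply: eq_big => u; last by case/andP=> /stable.
by apply: andb_id2l => /stable ->.
Qed.

Definition residual (v : G) : nat := residual_upto height_bound v.

(** The pieces are named by their vertex closest to the root. *)
Definition tops : {set G} := [set v | (v == r) || heavy (residual v)].

Lemma residualE v :
  residual v
  = (degree v + \sum_(u | (u \notin tops) && (parent u == v)) residual u)%N.
Proof.
rewrite {1}/residual -residual_upto_stable ?leq_addr //=; congr addn.
by apply: eq_bigl => u; rewrite !inE negb_or /child /residual /= -andbA andbCA andbC.
Qed.

Let step (v : G) : G := if v \in tops then v else parent v.

(** Climbing the tree until a top is met; every step decreases the depth, so
    [depth v] steps suffice. *)
Definition top (v : G) : G := iter (depth v) step v.

Lemma top_tops v : v \in tops -> top v = v.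
Proof. by rewrite /top => vT; elim: depth => //= k ->; rewrite /step vT. Qed.

Lemma iter_step_stable k v : (depth v <= k)%N -> iter k step v = top v /\ iter k step v \in tops.
Proof.
elim/ltn_ind: k v => k IH v le_k.
have [vT|vT] := boolP (v \in tops).
  suff it j : iter j step v = v by rewrite /top !it.
  by elim: j => //= j ->; rewrite /step vT.
have : v != r by move: vT; rewrite inE negb_or => /andP[].
case/tree/andP=> _ lt_d.
case: k IH le_k => [|k] IH; first by rewrite leqn0 => /eqP d0; rewrite d0 in lt_d.
move=> le_k; rewrite iterSr /step (negPf vT) -/step.
have le_pk : (depth (parent v) <= k)%N by rewrite -ltnS (leq_trans lt_d).
have [-> inT] := IH k (ltnSn k) _ le_pk; split=> //.
rewrite /top; case: (depth v) lt_d le_k => // d lt_d le_k.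
rewrite iterSr /step (negPf vT) -/step.
rewrite ltnS in lt_d; rewrite ltnS in le_k.
by have [-> _] := IH d le_k _ lt_d.
Qed.

Lemma top_in_tops v : top v \in tops.
Proof. by have [_] := iter_step_stable (leqnn (depth v)). Qed.

Lemma top_parent v : v \notin tops -> top v = top (parent v).
Proof.
move=> vT; have : v != r by move: vT; rewrite inE negb_or => /andP[].
case/tree/andP=> _ lt_d; rewrite /top.
case: (depth v) lt_d => // d lt_d; rewrite iterSr /step (negPf vT) -/step.
by have [-> _] := iter_step_stable lt_d.
Qed.

Definition piece (t : G) : {set G} := [set v | top v == t].

(** Sum [residualE] over the piece: the residuals of the vertices below t occur
    on both sides, once as summands and once in the recursion of their parent,
    and what is left after cancellation is the claim. *)
Lemma volume_piece t : t \in tops -> volume (piece t) = residual t.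
Proof.
move=> tT.
have split_top : (\sum_(v in piece t) residual v
   = residual t + \sum_(u in piece t | u \notin tops) residual u)%N.
  rewrite (bigD1 t) /=; last by rewrite inE top_tops.
  congr addn; apply: eq_bigl => u; apply: andb_id2l => /[!inE] /eqP ut.
  congr negb; apply/eqP/idP => [->|uT]; first by rewrite inE in tT.
  by rewrite -ut top_tops // inE.
have split_degree : (\sum_(v in piece t) residual v
   = volume (piece t) + \sum_(u in piece t | u \notin tops) residual u)%N.
  under eq_bigr => v _ do rewrite residualE.
  rewrite big_split /=; congr addn.
  rewrite (exchange_big_dep (fun u => (u \in piece t) && (u \notin tops))) /=.
    apply: eq_bigr => u /andP[ut uT]; rewrite (big_pred1 (parent u)) // => v /=.
    rewrite uT /= andbC eq_sym; case: eqP => [->|]; rewrite ?andbF //=.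
    by move: ut; rewrite !inE (top_parent uT) => ->.
  by move=> v u vt /andP[uT /eqP pu]; rewrite uT andbT; move: vt; rewrite !inE -pu (top_parent uT).
by apply/eqP; rewrite -(eqn_add2r (\sum_(u in piece t | u \notin tops) residual u)%N) -split_degree split_top.
Qed.

Lemma sum_residual_tops : (\sum_(t in tops) residual t = 2 * num_edges G)%N.
Proof.
rewrite -handshake [RHS](partition_big top (mem tops)) /=; last by move=> v _; apply: top_in_tops.
apply: eq_bigr => t tT; rewrite -volume_piece // /volume.
by apply: eq_bigl => v; rewrite inE.
Qed.

Lemma piece_inj : {in tops &, injective piece}.
Proof.
move=> t u tT uT /setP/(_ t); rewrite !inE (top_tops tT) eqxx => /esym/eqP; exact.
Qed.

Lemma pieces_partition : partition [set piece t | t in tops] [set: G].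
Proof.
apply/and3P; split.
- rewrite eqEsubset subsetT /=; apply/subsetP=> v _.
  by apply/bigcupP; exists (piece (top v)); rewrite ?imset_f ?top_in_tops // inE.
- apply/trivIsetP=> _ _ /imsetP[t _ ->] /imsetP[u _ ->] neq.
  rewrite -setI_eq0; apply/eqP/setP=> v; rewrite !inE.
  by apply: contraNF neq => /andP[/eqP-> /eqP->].
- apply/imsetP=> -[t tT /setP/(_ t)]; by rewrite !inE top_tops // eqxx.
Qed.

(** Each vertex other than a top contributes the edge to its parent, which lies
    in its own piece. *)
Lemma uncut_edges_le :
  (#|~: tops| <= \sum_(t in tops) num_edges_in (piece t))%N.
Proof.
rewrite -sum1_card (partition_big top (mem tops)) /=; last first.
  by move=> v _; apply: top_in_tops.
apply: leq_sum => t tT; rewrite sum1dep_card.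
set U := finset _.
have UP u : u \in U -> [/\ u \notin tops, adj u (parent u), (depth (parent u) < depth u)%N & top u = t].
  rewrite inE in_setC => /andP[uT /eqP ut].
  have : u != r by move: uT; rewrite inE negb_or => /andP[].
  by case/tree/andP.
rewrite -(card_in_imset (f := fun u => [set u; parent u])).
  apply: subset_leq_card; apply/subsetP=> _ /imsetP[u /UP[uT adj_u _ ut] ->].
  rewrite inE; apply/andP; split; first by apply/imset2P; exists u (parent u); rewrite ?inE.
  by apply/subsetP=> v /set2P[]->; rewrite inE ?ut -?top_parent ?ut.
move=> u v /UP[_ _ lt_u _] /UP[_ _ lt_v _] uv.
(* Two vertices with the same parent edge would be parents of each other. *)
have /set2P[//|up] : u \in [set v; parent v] by rewrite -uv !inE eqxx.
have /set2P[//|vp] : v \in [set u; parent u] by rewrite uv !inE eqxx.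
by move: lt_u; rewrite -vp up ltnNge ltnW.
Qed.

(** The children of v are neighbours of v, and a vertex other than the root has
    its parent as one more neighbour. *)
Lemma card_children v : (#|[set u | child v u]| + (v != r) <= degree v)%N.
Proof.
have childP u : u \in [set u | child v u] -> adj v u /\ (depth v < depth u)%N.
  by rewrite inE => /andP[/tree/andP[+ +]] /eqP pu; rewrite pu adj_sym.
have [_|vr] /= := eqVneq v r.
  rewrite addn0; apply: subset_leq_card; apply/subsetP=> u /childP[].
  by rewrite inE.
have /andP[adj_p lt_p] := tree vr.
have pN : parent v \notin [set u | child v u].
  by apply/negP => /childP[_]; rewrite ltnNge ltnW.
rewrite addnC -[(_ + _)%N]/(true + _)%N -pN -cardsU1.
apply: subset_leq_card; apply/subsetP=> u /setU1P[->|/childP[]]; by rewrite inE.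
Qed.

End CuttingTree.

(** * The partition for a real threshold *)

Section Threshold.

Variables (R : rcfType) (G : graph) (r : G).
Variables (parent : G -> G) (depth : G -> nat).
Hypothesis tree : rooted_tree r parent depth.
Variable s : R.
Hypothesis s_ge0 : 0 <= s.

Let heavy (x : nat) := s <= x%:R.
Let residual := residual r parent depth heavy.
Let tops := tops r parent depth heavy.
Let pieces := [set piece r parent depth heavy t | t in tops].

(** The top contributes at most the maximum degree, and each child still
    attached to it contributes less than s. *)
Lemma residual_le t :
  (residual t)%:R <= (max_degree G)%:R + s * ((max_degree G)%:R - (t != r)%:R).
Proof.
rewrite /residual (residualE tree) -/residual -/tops natrD natr_sum lerD //.
  by rewrite ler_nat degree_le_max.
apply: (@le_trans _ _ (\sum_(u | (u \notin tops) && (parent u == t)) s)).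
  apply: ler_sum => u /andP[+ _]; rewrite inE negb_or => /andP[_].
  by rewrite -ltNge => /ltW.
rewrite sumr_const -[s *+ _]mulr_natr; apply: ler_wpM2l => //.
rewrite lerBrDr -natrD ler_nat.
apply: leq_trans (degree_le_max t); apply: leq_trans (card_children tree t).
rewrite leq_add2r; apply: subset_leq_card; apply/subsetP=> u.
rewrite unfold_in => /andP[uT pu]; rewrite inE pu andbT.
by move: uT; rewrite inE negb_or => /andP[].
Qed.

(** The degree tax is controlled by bounding one factor of each squared volume
    by M and summing the other one to the total volume. *)
Lemma pieces_modularity_ge (M : R) :
  (0 < num_edges G)%N -> {in tops, forall t, (residual t)%:R <= M} ->
  (#|G|%:R - #|tops|%:R) / (num_edges G)%:R - M / (2%:R * (num_edges G)%:R)
    <= partition_modularity R pieces.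
Proof.
move=> m_gt0 le_M; rewrite /partition_modularity big_imset /=; last exact: piece_inj.
rewrite sumrB -mulr_suml -mulr_suml -natr_sum.
have m0 : (num_edges G)%:R != 0 :> R by rewrite pnatr_eq0 -lt0n.
have mp : (0 : R) < (num_edges G)%:R by rewrite ltr0n.
apply: lerB.
  rewrite ler_pM2r ?invr_gt0 // lerBlDr -natrD ler_nat addnC -(cardsC tops) leq_add2l.
  exact: uncut_edges_le.
have -> : M / (2 * (num_edges G)%:R)
   = M * (2 * num_edges G)%N%:R / (4 * (num_edges G)%:R ^+ 2).
  by rewrite natrM; field.
rewrite ler_pM2r ?invr_gt0 ?mulr_gt0 ?exprn_gt0 //.
rewrite -(sum_residual_tops tree heavy) natr_sum mulr_sumr; apply: ler_sum => t tT.
rewrite -/(volume _) (volume_piece tree tT) expr2; apply: ler_wpM2r (le_M t tT).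
exact: ler0n.
Qed.

(** Every top has residual at least s, except possibly the root. *)
Lemma heavy_tops_count : s * (#|tops|%:R - (~~ heavy (residual r))%:R) <= (2 * num_edges G)%:R.
Proof.
have rT : r \in tops by rewrite inE eqxx.
rewrite -(sum_residual_tops tree heavy) (bigD1 r) //= natrD natr_sum.
rewrite (cardsD1 r) rT natrD /= addrAC mulrDr lerD //.
  rewrite -/residual; have [le_s|] /= := boolP (heavy _); first by rewrite subr0 mulr1.
  by rewrite subrr mulr0 ler0n.
rewrite mulr_natr -sumr_const [leLHS](eq_bigl (fun t => (t \in tops) && (t != r))); last first.
  by move=> t; rewrite !inE andbC.
apply: ler_sum => t /andP[+ /negPf tr]; rewrite inE tr; exact.
Qed.

(** A light root piece costs 2 in the term 2 k, but lowers M by s >= 2, because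
    the weaker volume bound is needed for the root only. *)
Lemma tops_residual_tradeoff (D := (max_degree G)%:R) (m := (num_edges G)%:R) :
  2 <= s -> s <= 2 * m -> 0 < D ->
  exists2 M : R, {in tops, forall t, (residual t)%:R <= M}
    & 2 * #|tops|%:R + M <= D + D * s + 4 * m / s.
Proof.
move=> s_ge2 s_le D_gt0.
have s_gt0 : 0 < s by lra.
have count := heavy_tops_count; rewrite natrM -/m in count.
have count' : 2 * (#|tops|%:R - (~~ heavy (residual r))%:R) <= 4 * m / s.
  by rewrite ler_pdivlMr //; lra.
have [r_heavy|r_light] := boolP (heavy (residual r)); rewrite ?r_heavy ?r_light /= in count'.
  exists (D + D * s); last by lra.
  move=> t _; apply: le_trans (residual_le t) _; rewrite -/D.
  have := ler0n R (t != r); nra.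
have le_top t : t \in tops -> t != r -> (residual t)%:R <= D + s * (D - 1).
  by move=> _ tr; have := residual_le t; rewrite tr.
exists (D + s * (D - 1)); last by lra.
(* The root piece has volume below s, so it obeys the bound as soon as s does.
   A second piece has volume at least s, hence shows it; without a second
   piece the root piece would have volume 2 m >= s. *)
suff s_le_M : s <= D + s * (D - 1).
  move=> t tT; have [->|tr] := eqVneq t r; last exact: le_top.
  by move: r_light; rewrite /heavy -ltNge; lra.
have [/existsP[t /andP[tT tr]]|none] := boolP [exists t, (t \in tops) && (t != r)].
  apply: le_trans (le_top t tT tr).
  by move: tT; rewrite inE (negPf tr).
have : s <= (residual r)%:R.
  apply: le_trans s_le _; rewrite -natrM -(sum_residual_tops tree heavy) (big_pred1 r) //.
  move=> t; apply/idP/eqP => [tT|->]; last by rewrite inE eqxx.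
  by apply: contraNeq none => tr; apply/existsP; exists t; rewrite tT.
by rewrite -/(heavy _) (negPf r_light).
Qed.

End Threshold.

(** * The modularity bound *)

Lemma modularity_connected_ge (R : rcfType) (G : graph)
    (d := avg_degree R G) (D : R := (max_degree G)%:R) :
  connected G -> (2 <= #|G|)%N ->
  2%:R / d - 3%:R * Num.sqrt (D / (#|G|%:R * d)) - D / (#|G|%:R * d)
    <= modularity R G.
Proof.
move=> conn n_ge2.
have /card_gt1P[r [v [_ _ rv]]] := n_ge2.
have [parent [depth tree]] := spanning_tree_exists r conn.
have D_pos : (0 < max_degree G)%N.
  apply: leq_trans (degree_le_max v); rewrite /degree card_gt0.
  apply/set0Pn; exists (parent v); rewrite inE.
  by rewrite eq_sym in rv; case/andP: (tree v rv).
have D_le_m := max_degree_le_num_edges G.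
have m_pos : (0 < num_edges G)%N := leq_trans D_pos D_le_m.
pose m : R := (num_edges G)%:R.
pose n : R := #|G|%:R.
have D_ge1 : 1 <= D by rewrite ler1n.
have {}D_le_m : D <= m by rewrite ler_nat.
have n_gt0 : 0 < n by rewrite ltr0n ltnW.
have -> : #|G|%:R * d = 2 * m by rewrite /d /avg_degree -/n -/m; field; lra.
have -> : 2 / d = n / m by rewrite /d /avg_degree -/n -/m; field; lra.
pose y := Num.sqrt (D / (2 * m)); pose z := Num.sqrt (2 : R).
have z2 : z ^+ 2 = 2 by rewrite sqr_sqrtr.
have z_ge0 : 0 <= z := sqrtr_ge0 _.
have y2 : y ^+ 2 = D / (2 * m) by rewrite sqr_sqrtr // divr_ge0; lra.
have y_gt0 : 0 < y by rewrite sqrtr_gt0 divr_gt0; lra.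
have y2m : y ^+ 2 * (2 * m) = D by rewrite y2 divfK //; lra.
(* This s is sqrt (4 m / D), the threshold for which D s = 4 m / s.  Then
   2 <= s and s <= 2 m follow from D <= m and from D >= 1, m >= 1. *)
pose s := z / y.
have sy : s * y = z by rewrite /s divfK //; lra.
have s_ge0 : 0 <= s by rewrite divr_ge0 // ltW.
have s2 : s ^+ 2 * D = 4 * m.
  rewrite -y2m mulrA -exprMn sy z2; lra.
have s_ge2 : 2 <= s by rewrite -(@ler_pXn2r _ 2) ?nnegrE //; nra.
have s_le : s <= 2 * m by rewrite -(@ler_pXn2r _ 2) ?nnegrE //; nra.
have [M le_M tradeoff] := tops_residual_tradeoff tree s_ge0 s_ge2 s_le (lt_le_trans ltr01 D_ge1).
apply: le_trans (modularity_ge R (pieces_partition tree (fun x => s <= x%:R))).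
apply: le_trans (pieces_modularity_ge tree m_pos le_M).
rewrite -/y -/n -/m.
set k := #|_|%:R in tradeoff *.
have m_gt0 : 0 < m by lra.
have -> : (n - k) / m - M / (2 * m) = n / m - (2 * k + M) / (2 * m).
  by field; lra.
rewrite -addrA -opprD lerB //.
have e4 : 4 * m / s = D * s by rewrite -s2; field; lra.
have yz : D * s / m = 2 * (y * z).
  rewrite -y2m -sy; field; lra.
have : (2 * k + M) / (2 * m) <= (D + 2 * (D * s)) / (2 * m).
  rewrite ler_pM2r ?invr_gt0; last by lra.
  by move: tradeoff; rewrite -/m -/D e4; lra.
have -> : (D + 2 * (D * s)) / (2 * m) = D / (2 * m) + D * s / m by field; lra.
(* Here 2 z <= 3, that is 2 sqrt 2 <= 3. *)
rewrite yz; nra.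
Qed.

Theorem theorem6 (R : rcfType) (G : nat -> graph)
    (G_card : forall n : nat, (2 <= n)%N -> #|G n| = n)
    (G_connected : forall n : nat, (2 <= n)%N -> connected (G n)) :
  forall n : nat, (2 <= n)%N ->
  let d : R := avg_degree R (G n) in
  let Delta : R := (max_degree (G n))%:R in
  modularity R (G n) >=
    2%:R / d - 3%:R * Num.sqrt (Delta / (n%:R * d)) - Delta / (n%:R * d).
Proof.
move=> n n_ge2.
have := @modularity_connected_ge R (G n) (G_connected n n_ge2).
by rewrite (G_card n n_ge2); apply.
Qed.
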